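(* Let $n\ge1$, $W=\{0,\dots,n-1\}$, and let $q:W\times W\to[0,\infty)$ be a weakly irreducible kernel satisfying the reversibility assumption of the context. Let $$\mathcal F=\{(\rho_0,\dots,\rho_{n-1})\in[0,1]^n:\ \rho_i(1-\rho_j)q(i,j)=\rho_j(1-\rho_i)q(j,i)\ \text{for all } i\ne j \text{ in } W\}.$$ Then: (i) The mapping $\psi:\mathcal F\to[0,n]$ defined by $\psi(\rho_0,\dots,\rho_{n-1})=\sum_{i=0}^{n-1}\rho_i$ is a bijection. (ii) For every $i\in W$, the mapping $\widetilde\rho_i:[0,n]\to[0,1]$, $\rho\mapsto\widetilde\rho_i(\rho):=(\psi^{-1}(\rho))_i$, is continuous and nondecreasing.
   Context: For $i\ne j$ in $W$ write $i\to j$ if there is a path $(i=i_0,\dots,i_\ell=j)$ with $q(i_k,i_{k+1})>0$ for all $k<\ell$. The kernel $q$ is weakly irreducible if for all $i\ne j$, $i\to j$ or $j\to i$. Irreducibility classes are the equivalence classes of the relation ''$i=j$, or ($i\to j$ and $j\to i$)''. Reversibility assumption: for every irreducibility class $\mathcal C$ of $q$ there is a nonzero $\lambda:\mathcal C\to[0,\infty)$ such that $\lambda_iq(i,j)=\lambda_jq(j,i)$ for all $i,j\in\mathcal C$. *)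

(* Defs.v *)
From mathcomp Require Import all_boot all_order all_algebra.
From mathcomp Require Import all_classical all_reals all_analysis.
Set Implicit Arguments.
Unset Strict Implicit.
Unset Printing Implicit Defensive.
Import Order.TTheory GRing.Theory Num.Theory.
Import numFieldNormedType.Exports.
Local Open Scope classical_set_scope.
Local Open Scope ring_scope.

Section Kernel.
Variables (R : realType) (n : nat).
Implicit Type q : 'I_n -> 'I_n -> R.

(* Only used for i != j: [connect] also holds on the diagonal, through the
   empty path. *)
Definition leads_to q : rel 'I_n := connect [rel a b | 0 < q a b].

Definition weakly_irreducible q : Prop :=
  forall i j, i != j -> leads_to q i j \/ leads_to q j i.

Definition same_class q : rel 'I_n :=
  [rel i j | (i == j) || (leads_to q i j && leads_to q j i)].

Definition irreducibility_classes q : {set {set 'I_n}} :=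
  equivalence_partition (same_class q) [set: 'I_n]%SET.

(* [lambda] is defined on all of W, but only its values on C are constrained. *)
Definition reversible q : Prop :=
  forall C : {set 'I_n}, C \in irreducibility_classes q ->
  exists lambda : 'I_n -> R,
    [/\ forall i, i \in C -> 0 <= lambda i,
        exists2 i, i \in C & lambda i != 0
      & forall i j, i \in C -> j \in C -> lambda i * q i j = lambda j * q j i].

Definition calF q : set ('I_n -> R) :=
  [set rho | (forall i, 0 <= rho i <= 1) /\
     forall i j, i != j ->
       rho i * (1 - rho j) * q i j = rho j * (1 - rho i) * q j i].

Definition psi (rho : 'I_n -> R) : R := \sum_(i < n) rho i.

(* [pinv (calF q) psi] is the inverse of [psi] restricted to [calF q]; its
   values outside [psi @` calF q] are arbitrary. *)
Definition rho_tilde q (i : 'I_n) (r : R) : R := pinv (calF q) psi r i.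

End Kernel.

(* Main.v *)
(* Along an edge i -> j, two elements rho, rho' of calF satisfy: if
   rho i < rho' i or rho' i = 1, then rho j < rho' j or rho' j = 1.  With weak
   irreducibility this makes calF totally ordered for the pointwise order, so
   that psi is injective with a monotone inverse, each coordinate of which is
   1-Lipschitz because the nonnegative increments of all coordinates sum to the
   increment of psi.  For surjectivity, the classes are linearly ordered; fix
   one, put 1 on the states strictly after it, 0 on those before it, and
   l s / (1 - s + l s) on it, with l a reversible weight.  As s runs through
   [0, 1], the sum interpolates continuously between the numbers of states
   strictly after and weakly after the class, and these intervals cover
   [0, n]. *)
Require Import Defs.
From mathcomp Require Import all_boot all_order all_algebra.
From mathcomp Require Import all_classical all_reals all_analysis.
From mathcomp Require Import ring lra.
Set Implicit Arguments.
Unset Strict Implicit.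
Unset Printing Implicit Defensive.
Import Order.TTheory GRing.Theory Num.Theory.
Import numFieldNormedType.Exports.
Local Open Scope classical_set_scope.
Local Open Scope ring_scope.

Lemma connect_invariant (T : finType) (e : rel T) (P : T -> Prop) x y :
  (forall a b, e a b -> P a -> P b) -> connect e x y -> P x -> P y.
Proof.
move=> eP /connectP[p ep ->].
elim: p x ep => //= b p IHp x /andP[exb ebp] Px.
by apply: IHp ebp _; apply: eP exb Px.
Qed.

(** The net flow [x * (1 - y) * a - y * (1 - x) * b] strictly increases in [x] and is nonincreasing
    in [y], so two zeros of it move in the same direction. *)
Lemma balance_lt (R : realFieldType) (a b x x' y y' : R) :
  0 < a -> 0 < b -> 0 <= x <= 1 -> 0 <= x' <= 1 -> 0 <= y <= 1 ->
  0 <= y' <= 1 -> x * (1 - y) * a = y * (1 - x) * b ->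
  x' * (1 - y') * a = y' * (1 - x') * b -> x < x' -> y < y'.
Proof.
move=> a0 b0 /andP[x0 x1] /andP[x'0 x'1] /andP[y0 y1] /andP[y'0 y'1] E E' xx'.
rewrite ltNge; apply/negP => yy'.
have pos : 0 < a * (1 - y) + b * y.
  have [y_lt1|y_ge1] := ltP y 1.
    by rewrite ltr_pwDl ?mulr_gt0 ?subr_gt0 ?mulr_ge0 // ltW.
  have -> : y = 1 by lra.
  by rewrite subrr mulr0 add0r mulr1.
have h1 : 0 < (x' - x) * (a * (1 - y) + b * y) by rewrite mulr_gt0 ?subr_gt0.
have h2 : 0 <= (y - y') * (a * x' + b * (1 - x')).
  by rewrite mulr_ge0 ?subr_ge0 // addr_ge0 // mulr_ge0 ?subr_ge0 // ltW.
have : (x' - x) * (a * (1 - y) + b * y) + (y - y') * (a * x' + b * (1 - x'))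
     = (x' * (1 - y') * a - y' * (1 - x') * b)
       - (x * (1 - y) * a - y * (1 - x) * b) by ring.
rewrite E E' !subrr => h3; lra.
Qed.

Section WeaklyIrreducibleKernel.
Variables (R : realType) (n : nat) (q : 'I_n -> 'I_n -> R).
Hypothesis q_ge0 : forall i j, 0 <= q i j.

(** * Pointwise comparison of elements of [calF] *)

Lemma calF_edge rho rho' i j : calF q rho -> calF q rho' -> 0 < q i j ->
  rho i < rho' i \/ rho' i = 1 -> rho j < rho' j \/ rho' j = 1.
Proof.
move=> [b E] [b' E'] qij; have [->//|ij] := eqVneq i j.
have ri := b i.
have {E} := E i j ij; have {E'} := E' i j ij.
move=> E' E [lt_i|r'i1]; last first.
  right; move/eqP: E'; rewrite r'i1 subrr mulr0 mul0r mul1r mulf_eq0.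
  by rewrite (gt_eqF qij) orbF subr_eq0 eq_sym => /eqP.
(* On a one-way edge the balance of [rho'] reads [rho' i * (1 - rho' j) * q i j = 0], and
   [rho' i > rho i >= 0] forces [rho' j = 1]. *)
have := q_ge0 j i; rewrite le_eqVlt => /predU1P[qji|qji].
  right; move/eqP: E'; rewrite -qji mulr0 !mulf_eq0 (gt_eqF qij) orbF.
  rewrite gt_eqF; last by case/andP: ri => ri _; apply: le_lt_trans lt_i.
  by rewrite subr_eq0 eq_sym => /eqP.
by left; apply: (@balance_lt _ _ _ _ _ _ _ qij qji) E E' _.
Qed.

Lemma calF_leads_to rho rho' i j : calF q rho -> calF q rho' ->
  leads_to q i j -> rho i < rho' i -> rho j <= rho' j.
Proof.
move=> F F' ij lt_i.
have [/ltW//|->] : rho j < rho' j \/ rho' j = 1; last first.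
  by case: F => /(_ j)/andP[].
apply: (connect_invariant (P := fun x => rho x < rho' x \/ rho' x = 1)) ij _.
  by move=> a b /= ab; apply: calF_edge.
by left.
Qed.

Hypothesis q_irr : weakly_irreducible q.

Lemma calF_total rho rho' : calF q rho -> calF q rho' ->
  (forall i, rho i <= rho' i) \/ (forall i, rho' i <= rho i).
Proof.
move=> F F'; have [|/existsP[i]] := boolP [forall i, rho i <= rho' i].
  by move/forallP; left.
rewrite -ltNge => lt_i; right => j; rewrite leNgt; apply/negP => lt_j.
have ij : i != j by apply: contraTneq lt_j => <-; rewrite -leNgt ltW.
(* The coordinates [i] and [j] disagree in opposite senses; a path in either direction carries the
   strict inequality at its start to a weak one at its end, which is absurd. *)
have [ltij|ltji] := q_irr ij.
  by have := calF_leads_to F' F ltij lt_i; rewrite leNgt lt_j.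
by have := calF_leads_to F F' ltji lt_j; rewrite leNgt lt_i.
Qed.

Lemma calF_psi_mono rho rho' : calF q rho -> calF q rho' ->
  psi rho <= psi rho' -> forall i, 0 <= rho' i - rho i <= psi rho' - psi rho.
Proof.
move=> F F' le_psi i.
have step (f g : 'I_n -> R) : (forall i, f i <= g i) ->
    0 <= g i - f i <= psi g - psi f.
  move=> fg; rewrite subr_ge0 fg /= /psi -sumrB (bigD1 i) //= lerDl.
  by apply: sumr_ge0 => k _; rewrite subr_ge0.
have [/step//|ge] := calF_total F F'.
(* In the reversed order the sums must agree, so every increment vanishes. *)
have /andP[] := step _ _ ge; move: (ge i) le_psi; lra.
Qed.

Lemma calF_psi_inj : {in calF q &, injective (@psi R n)}.
Proof.
move=> rho rho' /set_mem F /set_mem F' eq_psi; apply/funext => i.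
have le_psi : psi rho <= psi rho' by rewrite eq_psi.
by have := calF_psi_mono F F' le_psi i; rewrite eq_psi subrr; lra.
Qed.

(** * Reachability and reversible weights *)

Lemma leads_to_refl i : leads_to q i i.
Proof. exact: connect0. Qed.

Lemma leads_to_trans j i k : leads_to q i j -> leads_to q j k -> leads_to q i k.
Proof. exact: connect_trans. Qed.

Lemma leads_to_edge i j : 0 < q i j -> leads_to q i j.
Proof. exact: (@connect1 _ [rel a b | 0 < q a b]). Qed.

Lemma same_classE i j : same_class q i j = leads_to q i j && leads_to q j i.
Proof.
by rewrite /same_class /= orb_idl // => /eqP->; rewrite leads_to_refl.
Qed.

Hypothesis q_rev : reversible q.

(* Positivity of a reversible weight propagates along the edges of the class. *)
Lemma reversible_gt0 i : exists l : 'I_n -> R,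
  (forall j, same_class q i j -> 0 < l j) /\
  (forall j k, same_class q i j -> same_class q i k ->
     l j * q j k = l k * q k j).
Proof.
pose C := [set y in [set: 'I_n] | same_class q i y]%SET.
have inC j : (j \in C) = same_class q i j by rewrite !inE.
have [|l [l_ge0 [k kC lk] lE]] := q_rev (C := C).
  by apply: imset_f; rewrite inE.
exists l; split=> [j|j j' jC j'C]; last by apply: lE; rewrite inC.
move: kC; rewrite inC !same_classE => /andP[ik ki] /andP[ij ji].
have kj := leads_to_trans ki ij; have jk := leads_to_trans ji ik.
have backC x : leads_to q k x -> leads_to q x k -> x \in C.
  move=> kx xk; rewrite inC same_classE (leads_to_trans ik kx) /=.
  exact: leads_to_trans xk ki.
(* An intermediate state is known to lie in the class only once it leads back to [k], so the
   invariant asserts positivity under that condition. *)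
suff [_] : leads_to q k j /\ (leads_to q j k -> 0 < l j) by apply.
apply: (connect_invariant (P := fun x => leads_to q k x /\
  (leads_to q x k -> 0 < l x))) kj _ => [a b ab [ka la]|]; last first.
  split=> [|_]; first exact: leads_to_refl.
  by rewrite lt_def lk l_ge0 // inC same_classE ik.
have kb := leads_to_trans ka (leads_to_edge ab); split=> // bk.
have ak := leads_to_trans (leads_to_edge ab) bk.
have := mulr_gt0 (la ak) ab; rewrite lE ?backC //.
rewrite [0 < l b]lt_def l_ge0 ?backC // andbT.
by case: eqP => // ->; rewrite mul0r ltxx.
Qed.

(** * Linear order of the classes *)

Definition down i : {set 'I_n} := [set j | leads_to q i j]%SET.

Definition below i : {set 'I_n} :=
  [set j | leads_to q i j & ~~ leads_to q j i]%SET.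

Lemma down_sub i j : leads_to q i j -> down j \subset down i.
Proof.
by move=> ij; apply/fintype.subsetP => k; rewrite !inE; apply: leads_to_trans.
Qed.

Lemma down_notin_below i j :
  j \in down i -> j \notin below i -> same_class q i j.
Proof. by rewrite same_classE !inE => -> /= /negPn. Qed.

(** Cardinality ranks the classes: if instead [j] leads to [i], then [down i] lies inside [down j],
    the size bound makes them equal, and so [j] is in [down i]. *)
Lemma card_down_le i j : (#|down j| <= #|down i|)%N -> leads_to q i j.
Proof.
move=> le_ji; have [->|ij] := eqVneq i j; first exact: leads_to_refl.
have [//|ji] := q_irr ij.
have/eqP eq_ij : down i == down j by rewrite eqEcard down_sub.
have : j \in down j by rewrite inE leads_to_refl.
by rewrite -eq_ij inE.
Qed.

(** A nonempty [below i] is covered by [down k] for its member [k] of highest rank. As [k] does not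
    lead back to [i], minimality of [i] excludes [r <= #|down k|]. *)
Lemma card_below_le (r : R) i :
  (forall k, r <= #|down k|%:R -> (#|down i| <= #|down k|)%N) ->
  0 <= r -> #|below i|%:R <= r.
Proof.
move=> min_i r0; have [->|[k0 k0i]] := set_0Vmem (below i).
  by rewrite cards0.
have [k] :=
  arg_maxnP (P := fun k => k \in below i) (fun k => #|down k|) k0i.
rewrite !inE => /andP[ik ki] max_k.
have sub : below i \subset down k.
  by apply/fintype.subsetP => j /max_k; rewrite inE; apply: card_down_le.
apply: le_trans (_ : #|down k|%:R <= r).
  by rewrite ler_nat subset_leq_card.
rewrite leNgt; apply: contra ki => /ltW/min_i; exact: card_down_le.
Qed.

Lemma exists_threshold (r : R) : (0 < n)%N -> 0 <= r <= n%:R ->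
  exists i, #|below i|%:R <= r <= #|down i|%:R.
Proof.
move=> n0 /andP[r0 rn].
(* A state of highest rank reaches all [n] states, so some [down] has size at least [r]; a smallest
   such one is the threshold. *)
have [i1 _ max_i1] := @arg_maxnP _ (Ordinal n0) xpredT (fun k => #|down k|) isT.
have i1P : r <= #|down i1|%:R.
  suff -> : down i1 = [set: 'I_n]%SET by rewrite cardsT card_ord.
  by apply/setP => j; rewrite !inE; apply: card_down_le; apply: max_i1.
have [i ri min_i] := arg_minnP (P := fun k => r <= #|down k|%:R)
  (fun k => #|down k|) i1P.
by exists i; rewrite ri card_below_le.
Qed.

(** * The one-parameter family attached to a class *)

Definition tilt (l s : R) := l * s / (1 - s + l * s).

Lemma tilt_denom_gt0 (l s : R) : 0 < l -> 0 <= s <= 1 -> 0 < 1 - s + l * s.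
Proof.
move=> l0 /andP[]; rewrite le_eqVlt => /predU1P[<- _|s0 s1].
  by rewrite mulr0 addr0 subr0.
by rewrite ltr_wpDl ?mulr_gt0 ?subr_ge0.
Qed.

(** For [s < 1] this shows that [tilt l] multiplies the odds [s / (1 - s)] by [l], which is what
    detailed balance inside a class requires. *)
Lemma tiltC (l s : R) : 0 < l -> 0 <= s <= 1 ->
  1 - tilt l s = (1 - s) / (1 - s + l * s).
Proof.
move=> l0 s01; have d0 := tilt_denom_gt0 l0 s01.
by rewrite /tilt; field; rewrite gt_eqF.
Qed.

Lemma tilt_itv (l s : R) : 0 < l -> 0 <= s <= 1 -> 0 <= tilt l s <= 1.
Proof.
move=> l0 s01; have d0 := tilt_denom_gt0 l0 s01.
rewrite -[_ <= 1]subr_ge0 tiltC // !divr_ge0 ?(ltW d0) //; move: s01; try lra.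
by case/andP=> s0 _; rewrite mulr_ge0 // ltW.
Qed.

Lemma tilt_continuous (l : R) : 0 < l -> {within `[0, 1], continuous (tilt l)}.
Proof.
move=> l0; apply/subspace_continuousP => s /= s01.
apply: cvg_within_filter; apply: cvgM.
  by apply: cvgMr; apply: cvg_id.
apply: cvgV; first by rewrite gt_eqF // tilt_denom_gt0 // -in_itv.
apply: cvgD; first by apply: cvgB; [exact: cvg_cst|exact: cvg_id].
by apply: cvgMr; apply: cvg_id.
Qed.

Definition profile i (l : 'I_n -> R) (s : R) : 'I_n -> R := fun j =>
  if j \in below i then 1 else if j \in down i then tilt (l j) s else 0.

Lemma calF_profile i l (s : R) :
  (forall j, same_class q i j -> 0 < l j) ->
  (forall j k, same_class q i j -> same_class q i k ->
     l j * q j k = l k * q k j) ->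
  0 <= s <= 1 -> calF q (profile i l s).
Proof.
move=> l_gt0 lE s01.
have classE := @down_notin_below i.
have no_edge_down x y : x \in down i -> y \notin down i -> q x y = 0.
  rewrite !inE => ix iy; apply/eqP; rewrite eq_le q_ge0 andbT leNgt.
  by apply: contra iy => /leads_to_edge; apply: leads_to_trans.
have no_edge_below x y : x \in below i -> y \notin below i -> q x y = 0.
  rewrite !inE => /andP[ix xi] iy; apply/eqP; rewrite eq_le q_ge0 andbT leNgt.
  apply: contra iy => /leads_to_edge xy; rewrite (leads_to_trans ix xy) /=.
  by apply: contra xi; apply: leads_to_trans.
split=> [j|a b _]; rewrite /profile.
  case: ifPn => jb; first by rewrite ler01 lexx.
  case: ifPn => jd; last by rewrite ler01 lexx.
  by rewrite tilt_itv // l_gt0 // classE.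
(* Across two levels, the missing edge kills one side of the balance and an extreme value 0 or 1
   kills the other. *)
case: (boolP (a \in below i)) => ab; case: (boolP (b \in below i)) => bb;
  first by rewrite subrr !mulr0 !mul0r.
- by rewrite no_edge_below // subrr !mulr0 mul0r.
- by rewrite (no_edge_below b a) // subrr !mulr0 mul0r.
case: (boolP (a \in down i)) => ad; case: (boolP (b \in down i)) => bd;
  last by rewrite !mul0r.
- have [aC bC] := (classE a ad ab, classE b bd bb).
  rewrite !tiltC ?l_gt0 // /tilt.
  set u := (_ + l a * s)^-1; set v := (_ + l b * s)^-1.
  (* The second factor is symmetric in [a] and [b]; reversibility swaps them in the first. *)
  transitivity ((l a * q a b) * (s * (1 - s) * u * v)); first by ring.
  by rewrite lE //; ring.
- by rewrite (no_edge_down a b) // mulr0 !mul0r.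
- by rewrite (no_edge_down b a) // mulr0 !mul0r.
Qed.

Lemma psi_profile_continuous i l : (forall j, same_class q i j -> 0 < l j) ->
  {within `[0, 1], continuous (fun s => psi (profile i l s))}.
Proof.
move=> l_gt0; apply/subspace_continuousP => s /= s01.
apply: cvg_big; first exact: add_continuous.
move=> j _; rewrite /profile; case: ifPn => jb; first exact: cvg_cst.
case: ifPn => jd; last exact: cvg_cst.
move: s s01; apply/subspace_continuousP/tilt_continuous/l_gt0.
exact: down_notin_below jd jb.
Qed.

(** * Range of [psi] *)

Lemma psi_indicator (A : {set 'I_n}) :
  psi (fun j => (j \in A)%:R : R) = #|A|%:R.
Proof. by rewrite /psi -natr_sum -sum1_card [in RHS]big_mkcond. Qed.

Lemma psi_surj : (0 < n)%N -> set_surj (calF q) `[0, n%:R] (@psi R n).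
Proof.
move=> n0 r /=; rewrite in_itv /= => r0n.
have [i /andP[ri ir]] := exists_threshold n0 r0n.
have [l [l_gt0 lE]] := reversible_gt0 i.
have at0 : psi (profile i l 0) = #|below i|%:R.
  rewrite -psi_indicator; congr psi; apply/funext => j; rewrite /profile /tilt.
  by rewrite mulr0 mul0r if_same; case: ifP.
have at1 : psi (profile i l 1) = #|down i|%:R.
  rewrite -psi_indicator; congr psi; apply/funext => j; rewrite /profile.
  case: ifPn => [|jb]; first by rewrite !inE => /andP[->].
  case: ifPn => // jd; rewrite /tilt subrr add0r mulr1 divff // gt_eqF //.
  exact/l_gt0/down_notin_below.
have [|s s01 <-] := IVT (v := r) (@ler01 R) (psi_profile_continuous l_gt0).
  by rewrite at0 at1 ge_min ri le_max ir orbT.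
by exists (profile i l s) => //; apply: calF_profile.
Qed.

Lemma psi_fun : set_fun (calF q) `[0, n%:R] (@psi R n).
Proof.
move=> rho [b _] /=; rewrite in_itv /= /psi sumr_ge0 => [|j _]; last first.
  by case/andP: (b j).
rewrite -[n in n%:R]card_ord -sum1_card natr_sum; apply: ler_sum => j _.
by case/andP: (b j).
Qed.

End WeaklyIrreducibleKernel.

Unset Implicit Arguments.

Theorem proposition2p1 (R : realType) (n : nat) (q : 'I_n -> 'I_n -> R)
    (hn : (1 <= n)%N)
    (hq : forall i j : 'I_n, 0 <= q i j)
    (hirr : weakly_irreducible q)
    (hrev : reversible q) :
  set_bij (calF q) `[0, n%:R] (@psi R n) /\
  forall i : 'I_n,
    [/\ set_fun `[0, n%:R] `[0, 1] (rho_tilde q i),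
        {within `[0, n%:R], continuous (rho_tilde q i)}
      & forall x y : R, x \in `[0, n%:R] -> y \in `[0, n%:R] -> x <= y ->
          rho_tilde q i x <= rho_tilde q i y].
Proof.
have surj : set_surj (calF q) `[0, n%:R] (@psi R n) by apply: psi_surj.
split; first by split=> //; [exact: psi_fun|exact: calF_psi_inj].
have psiK x : x \in `[0, n%:R] -> psi (pinv (calF q) (@psi R n) x) = x.
  by move=> x0n; apply: (surjpK _ surj); rewrite inE.
have pinvF x : x \in `[0, n%:R] -> calF q (pinv (calF q) (@psi R n) x).
  by move=> x0n; apply: (@surjpinv_image_sub _ _ _ _ _ _ surj); exists x.
(* The left bound gives monotonicity, the right one the Lipschitz constant 1. *)
have mono i x y : x \in `[0, n%:R] -> y \in `[0, n%:R] -> x <= y ->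
    0 <= rho_tilde q i y - rho_tilde q i x <= y - x.
  move=> x0n y0n xy; have := calF_psi_mono hq hirr (pinvF x x0n) (pinvF y y0n).
  by rewrite !psiK //; apply.
move=> i; split=> [x /pinvF[+ _]||x y x0n y0n xy].
- by move/(_ i); rewrite /= in_itv.
- apply/subspace_continuousP => x x0n; apply/cvgrPdist_le => e e0.
  rewrite near_withinE; near=> y => y0n.
  (* By the Lipschitz bound, a distance at most [e] between the arguments suffices. *)
  apply: le_trans (_ : `|x - y| <= e); last first.
    by near: y; apply: (@cvgr_dist_le _ _ _ _ _ id); first exact: cvg_id.
  have [xy|/ltW yx] := leP x y.
    have := mono i x y x0n y0n xy => /andP[h1 h2].
    by rewrite distrC ger0_norm // distrC (le_trans h2) // ler_norm.
  have := mono i y x y0n x0n yx => /andP[h1 h2].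
  by rewrite ger0_norm // (le_trans h2) // ler_norm.
- by have := mono i x y x0n y0n xy => /andP[]; rewrite subr_ge0.
Unshelve. all: by end_near.
Qed.
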